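(* Let $X$ be a Čech-complete topological group and $K$ a compact group. If $G\subseteq CHom(X,K)$ is not equicontinuous, then $G$ contains a countably infinite subset $L$ such that $\overline{L}^{K^X}$ is canonically homeomorphic to $\beta L$, when $L$ is equipped with the discrete topology. In case $K=\mathbb{U}(n)$, the unitary group of degree $n$, it follows that $L$ is a $\mathbb{C}^{n^2}$-interpolation set.
   Context: All topological spaces (and groups) are assumed to be infinite, completely regular and Hausdorff. A space is Čech-complete if it is a $G_\delta$-subset of its Stone-Čech compactification. $CHom(X,K)$ is the set of all continuous homomorphisms of $X$ into $K$. $\overline{L}^{K^X}$ is the closure of $L$ in $K^X$ with the product (pointwise convergence) topology. Equicontinuity is with respect to the unique compatible uniformity of the compact group $K$. $\beta L$ is the Stone-Čech compactification of the discrete set $L$; ''canonically homeomorphic'' means that the continuous extension $\beta L\to\overline{L}^{K^X}$ of the identity map of $L$ is a homeomorphism. For $K=\mathbb{U}(n)\subseteq\mathbb{C}^{n^2}$, view $L\subseteq \mathbb{U}(n)^X\subseteq(\mathbb{C}^{n^2})^X$. $L$ is a $\mathbb{C}^{n^2}$-interpolation set if for each function $h\colon L\to\mathbb{C}^{n^2}$ with relatively compact (i.e. bounded) range there is a continuous map $f\colon(\mathbb{C}^{n^2})^X\to\mathbb{C}^{n^2}$ (product topology on the domain) with $f|_L=h$. *)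

(* Defs.v *)
From HB Require Import structures.
From mathcomp Require Import all_boot all_order all_algebra.
From mathcomp Require Import all_classical all_reals all_analysis.
From mathcomp Require Import borel_hierarchy.
From mathcomp Require Import complex.

Set Implicit Arguments.
Unset Strict Implicit.
Unset Printing Implicit Defensive.

Import Order.TTheory GRing.Theory Num.Theory.
Import numFieldNormedType.Exports.

Local Open Scope classical_set_scope.
Local Open Scope ring_scope.

HB.mixin Record isTopologicalGroup G & Topological G & Group G := {
  mulg_continuous : continuous (fun xy : G * G => (xy.1 * xy.2)%g);
  invg_continuous : continuous (fun x : G => (x^-1)%g)
}.

#[short(type="topologicalGroupType")]
HB.structure Definition TopologicalGroup :=
  {G of Topological G & Group G & isTopologicalGroup G}.

(* A topological group together with a uniformity inducing its topology. When
   the group is compact and Hausdorff this uniformity is unique, so that it is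
   no additional data. The base point has no mathematical role: it is there
   because [equicontinuous] is defined for maps into pointed uniform spaces. *)
#[short(type="uniformGroupType")]
HB.structure Definition UniformGroup :=
  {G of PointedUniform G & TopologicalGroup G}.

Definition CHom (X K : topologicalGroupType) : set (X -> K) :=
  [set f | continuous f /\ {morph f : x y / (x * y)%g}].
Arguments CHom : clear implicits.

Definition homeomorphism (S T : topologicalType) (f : S -> T) :=
  continuous f /\ exists g : T -> S, [/\ continuous g, cancel f g & cancel g f].

(* The Stone-Cech compactification of X is realized as the closure of the image
   of X in the cube indexed by the continuous maps from X to [0, 1]. It is meant
   for completely regular Hausdorff X, for which [stone_cech_unit] is an
   embedding. *)
Section StoneCech.
Variables (R : realType) (X : topologicalType).

Definition unit_map := {f : X -> R | continuous f /\ range f `<=` `[0, 1]}.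

Definition stone_cech_eval (x : X) : {ptws unit_map -> R} :=
  fun f => sval f x.

Definition stone_cech_set : set {ptws unit_map -> R} :=
  closure (range stone_cech_eval).

Definition stone_cech : topologicalType := set_type stone_cech_set.

Definition stone_cech_unit (x : X) : stone_cech :=
  SigSub (mem_set (subset_closure (imageT stone_cech_eval x))).

Definition cech_complete := Gdelta (range stone_cech_unit).

End StoneCech.

(* The continuous extension of the inclusion of L to the compactification of the
   discrete set L is unique, because the image of L is dense and K^X is
   Hausdorff: it is the map phi below. *)
Definition closure_canonically_beta (R : realType) (X : Type)
    (K : topologicalType) (L : set {ptws X -> K}) :=
  exists phi : stone_cech R (discrete_topology L) -> closure L,
    homeomorphism phi /\
    forall l : L, set_val (phi (stone_cech_unit R (l : discrete_topology L))) =
                  set_val l.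

(* Only the values of h on L matter: as M is inhabited whenever L and X are, every
   map from L to M is the restriction of some h. *)
Definition interpolation_set (X : Type) (M : topologicalType)
    (L : set (X -> M)) :=
  forall h : (X -> M) -> M, precompact (h @` L) ->
    exists f : {ptws X -> M} -> M, continuous f /\ forall g, L g -> f g = h g.

(* The usual topology of the complex numbers, given by the modulus. *)
HB.instance Definition _ (R : rcfType) := PseudoPointedMetric.copy R[i] R[i]^o.
HB.instance Definition _ (R : rcfType) := NormedModule.copy R[i] R[i]^o.

Fact continuous_matrix (T S : topologicalType) m n (f : T -> 'M[S]_(m, n)) :
  (forall i j, continuous (fun x => f x i j)) -> continuous f.
Proof.
move=> cf x A [P nP sPA]; apply: (filterS sPA).
apply: filter_forall => i; apply: filter_forall => j.
exact: (cf i j x _ (nP i j)).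
Qed.

Fact conjC_continuous (C : numClosedFieldType) : continuous (@Num.conj C).
Proof.
move=> x A [e e0 sA]; exists e => // y xye; apply: sA.
by rewrite /= -rmorphB norm_conjC.
Qed.

(* U(n) with the topology and uniformity induced by the entrywise ones on n x n
   complex matrices, i.e. on C^(n^2). *)
Section UnitaryGroup.
Variables (R : realType) (n : nat).

Definition unitary_set : set 'M[R[i]]_n := [set A | A \is unitarymx].
Definition unitary_group : Type := set_type unitary_set.

HB.instance Definition _ := Uniform.copy unitary_group (set_type unitary_set).

Fact unitary_one_subproof : unitary_set 1%:M.
Proof. by apply/unitarymxP; rewrite trmx1 map_mx1 mulmx1. Qed.

Fact unitary_mul_subproof (A B : unitary_group) :
  unitary_set (set_val A *m set_val B).
Proof.
by apply: mul_unitarymx; [exact: (set_mem (valP A))|exact: (set_mem (valP B))].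
Qed.

Fact unitary_inv_subproof (A : unitary_group) : unitary_set ((set_val A)^t*)%sesqui.
Proof. by rewrite /unitary_set/= trmxC_unitary; exact: (set_mem (valP A)). Qed.

Definition unitary_one : unitary_group := SigSub (mem_set unitary_one_subproof).
Definition unitary_mul (A B : unitary_group) : unitary_group :=
  SigSub (mem_set (unitary_mul_subproof A B)).
Definition unitary_inv (A : unitary_group) : unitary_group :=
  SigSub (mem_set (unitary_inv_subproof A)).

Fact unitary_mulA : associative unitary_mul.
Proof. by move=> A B C; apply/val_inj; rewrite /= mulmxA. Qed.
Fact unitary_mul1 : left_id unitary_one unitary_mul.
Proof. by move=> A; apply/val_inj; rewrite /= mul1mx. Qed.
Fact unitary_mulr1 : right_id unitary_one unitary_mul.
Proof. by move=> A; apply/val_inj; rewrite /= mulmx1. Qed.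
Fact unitary_mulrV : right_inverse unitary_one unitary_inv unitary_mul.
Proof.
by move=> A; apply/val_inj => /=; apply/unitarymxP; exact: (set_mem (valP A)).
Qed.
Fact unitary_mulV : left_inverse unitary_one unitary_inv unitary_mul.
Proof.
by move=> A; apply/val_inj/mulmx1C; move/(congr1 val): (unitary_mulrV A).
Qed.

HB.instance Definition _ := isGroup.Build unitary_group
  unitary_mulA unitary_mul1 unitary_mulr1 unitary_mulV unitary_mulrV.
HB.instance Definition _ := isPointed.Build unitary_group unitary_one.

Fact unitary_coord_continuous i j :
  continuous (fun A : unitary_group => set_val A i j).
Proof.
move=> A; apply: (@continuous_comp _ _ _ (set_val : unitary_group -> 'M[R[i]]_n)
  (fun M => M i j)).
  exact: initial_continuous.
exact: (@coord_continuous R[i] n n i j).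
Qed.

Fact unitary_mul_continuous :
  continuous (fun AB : unitary_group * unitary_group => (AB.1 * AB.2)%g).
Proof.
apply: continuous_comp_initial; apply: continuous_matrix => i j /= AB.
rewrite (_ : (fun _ => _) = fun AB : unitary_group * unitary_group =>
  \sum_k set_val AB.1 i k * set_val AB.2 k j); last first.
  by apply/funext => -[A B]; rewrite mxE.
apply: cvg_big => [|k _]; first exact: add_continuous.
apply: (@continuousM R[i]).
- apply: (@continuous_comp _ _ _ fst (fun A : unitary_group => set_val A i k)).
    exact: cvg_fst.
  exact: unitary_coord_continuous.
- apply: (@continuous_comp _ _ _ snd (fun A : unitary_group => set_val A k j)).
    exact: cvg_snd.
  exact: unitary_coord_continuous.
Qed.

Fact unitary_inv_continuous : continuous (fun A : unitary_group => (A^-1)%g).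
Proof.
apply: continuous_comp_initial; apply: continuous_matrix => i j /= A.
rewrite (_ : (fun _ => _) = fun A : unitary_group => Num.conj (set_val A j i));
  last by apply/funext => B; rewrite !mxE.
apply: (@continuous_comp _ _ _ (fun A : unitary_group => set_val A j i)).
  exact: unitary_coord_continuous.
exact: conjC_continuous.
Qed.

HB.instance Definition _ := isTopologicalGroup.Build unitary_group
  unitary_mul_continuous unitary_inv_continuous.

End UnitaryGroup.

(* Main.v *)
Require Import Defs.
From mathcomp Require Import all_boot all_order all_algebra.
From mathcomp Require Import all_classical all_reals all_analysis.
From mathcomp Require Import complex.
From mathcomp Require Import ring lra.

(** A non-equicontinuous family of homomorphisms is so uniformly: there are a
    neighbourhood V of 1 in K and a cluster point h in K^X such that members g of
    G arbitrarily close to h satisfy g w \notin V for w arbitrarily close to 1.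
    As K is compact, some k in K has the property that, for every neighbourhood
    D of k, h^-1(D) is dense in some nonempty open set. Build a Cantor scheme of
    open sets there: in each of the finitely many open sets of a level choose p
    with h p \in D, then one g and one w with g p near h p for all these p and
    g w \notin V. Then g p is near k, while g (p * w) = g p * g w is far from k:
    the two sets around p and p * w are the children. Cech-completeness puts a
    point in every branch, so every 0-1 pattern on the resulting sequence (g_n)
    is realized by a single x, with the same two disjoint closed sets in K for
    all patterns. Hence disjoint subsets of L = {g_n} have disjoint closures,
    which characterizes beta L. For U(n) a bounded function on L is a sum of
    signs weighted by powers of 1/2, and each sign pattern is the restriction of
    a continuous function of the value at one point. *)

Set Implicit Arguments.
Unset Strict Implicit.
Unset Printing Implicit Defensive.

Import Order.TTheory GRing.Theory Num.Theory.
Import numFieldNormedType.Exports.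

Local Open Scope classical_set_scope.
Local Open Scope ring_scope.

(** * Compactness and separation in products and subspaces *)

Lemma ptws_eval_continuous (X : Type) (K : topologicalType) (x : X) :
  continuous (fun f : {ptws X -> K} => f x).
Proof. exact: (@proj_continuous {classic X} (fun=> K) x). Qed.

Lemma ptws_compact (X : Type) (K : topologicalType) (A : set K) :
  compact A -> compact [set f : {ptws X -> K} | forall x, A (f x)].
Proof. by move=> cA; exact: (@tychonoff {classic X} (fun=> K) (fun=> A)). Qed.

Lemma ptws_hausdorff (X : Type) (K : topologicalType) :
  hausdorff_space K -> hausdorff_space {ptws X -> K}.
Proof. by move=> hK; apply: (@hausdorff_product {classic X} (fun=> K)). Qed.

Lemma set_val_continuous (T : topologicalType) (A : set T) :
  continuous (set_val : A -> T).
Proof. exact: initial_continuous. Qed.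

Lemma set_type_compact (T : topologicalType) (A : set T) :
  compact A -> compact [set: A].
Proof.
move=> cA F FF _.
have [|p [Ap clp]] := cA (set_val @ F) (fmap_proper_filter _ FF).
  suff : F (set_val @^-1` A) by [].
  by apply: filterS filterT => a _; exact: (set_mem (valP a)).
exists (SigSub (mem_set Ap)); split=> // S N FS [_ [[W oW <-] Wp sWN]].
have FvS : F (set_val @^-1` (set_val @` S)) by apply: filterS FS => s Ss; exists s.
have [|_ [[s Ss <-] Ws]] := clp _ W FvS.
  by apply: open_nbhs_nbhs; split.
by exists s; split=> //; apply: sWN.
Qed.

Lemma injective_hausdorff (S T : topologicalType) (f : S -> T) :
  continuous f -> injective f -> hausdorff_space T -> hausdorff_space S.
Proof.
move=> cf fI hT p q clpq; apply/fI/hT => A B /cf pA /cf qB.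
by have [s [As Bs]] := clpq _ _ pA qB; exists (f s).
Qed.

Lemma set_type_hausdorff (T : topologicalType) (A : set T) :
  hausdorff_space T -> hausdorff_space A.
Proof. exact: injective_hausdorff (@set_val_continuous _ _) val_inj. Qed.

Lemma compact_hausdorff_regular (T : topologicalType) :
  hausdorff_space T -> compact [set: T] -> regular_space T.
Proof.
by move=> hT cT x; apply: (compact_regular hT cT); exact: filterT.
Qed.

Lemma regular_closed_nbhs (T : topologicalType) (x : T) (U : set T) :
  regular_space T -> nbhs x U -> exists N, [/\ nbhs x N, closed N & N `<=` U].
Proof.
move=> rT /rT [N xN sNU]; exists (closure N); split=> //.
  by apply: filterS xN; exact: subset_closure.
exact: closed_closure.
Qed.

Lemma closure_sub_closed (T : topologicalType) (A C : set T) :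
  closed C -> A `<=` C -> closure A `<=` C.
Proof.
by move=> cC sAC x clx; apply: cC => U xU; have [y [/sAC]] := clx U xU; exists y.
Qed.

(** * Compactifications in which complementary subsets have disjoint closures *)

(** [phi z] is a cluster point of [j] along the traces on [L] of the neighbourhoods of [z];
    disjointness of the closures makes this choice continuous. *)
Lemma continuous_extension (L : Type) (Y1 Y2 : topologicalType)
    (i : L -> Y1) (j : L -> Y2) :
  closure (range i) = setT ->
  (forall A, closure (i @` A) `&` closure (i @` ~` A) = set0) ->
  hausdorff_space Y2 -> compact [set: Y2] ->
  exists2 phi : Y1 -> Y2, continuous phi & forall l, phi (i l) = j l.
Proof.
move=> di sepi h2 c2; have r2 := compact_hausdorff_regular h2 c2.
have PF (z : Y1) : ProperFilter (filter_from (nbhs z) (fun N => i @^-1` N)).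
  apply: filter_from_proper.
    apply: filter_from_filter; first by exists setT; exact: filterT.
    by move=> M N zM zN; exists (M `&` N) => //; exact: filterI.
  move=> N zN; have : closure (range i) z by rewrite di.
  by case/(_ N zN) => _ [[l _ <-] Nl]; exists l.
have /choice[phi phiP] (z : Y1) : exists p,
    cluster (j @ filter_from (nbhs z) (fun N => i @^-1` N)) p.
  by have [|p [_ clp]] := c2 (j @ filter_from (nbhs z) (fun N => i @^-1` N)) _;
    [exact: filterT | exists p].
(* The traces on L of the neighbourhoods of z meet [j @^-1` N], so z lies in the
   closure of its image. *)
have key z N : nbhs (phi z) N -> closed N ->
    ~ closure (i @` ~` (j @^-1` N)) z.
  move=> zN cN clz.
  have /(_ z) : forall z, ~ (closure (i @` (j @^-1` N)) z /\
      closure (i @` ~` (j @^-1` N)) z).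
    by move=> z' cz; have : (set0 : set Y1) z' by rewrite -(sepi (j @^-1` N)).
  apply; split=> // M zM.
  have [] := phiP z (j @` (i @^-1` M)) N _ zN.
    by exists M => // l Ml; exists l.
  by move=> _ [[l Ml <-] Nl]; exists (i l); split=> //; exists l.
exists phi => [z U zU|l].
  have [N [zN cN sNU]] := regular_closed_nbhs r2 zU.
  have oM : nbhs z (~` closure (i @` ~` (j @^-1` N))).
    apply: open_nbhs_nbhs; split; last exact: key.
    by apply: closed_openC; exact: closed_closure.
  (* Near such a [z'] only points of [L] sent into [N] are seen, so the cluster point [phi z'] lies
     in the closed set [N]. *)
  apply: filterS oM => z' Mz'; apply/sNU/cN => V z'V.
  have oM : nbhs z' (~` closure (i @` ~` (j @^-1` N))).
    apply: open_nbhs_nbhs; split=> //.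
    by apply: closed_openC; exact: closed_closure.
  have [] := phiP z' (j @` (j @^-1` N)) V _ z'V.
    exists (~` closure (i @` ~` (j @^-1` N))) => // l nl; exists l => //.
    by apply: contrapT => Nl; apply: nl; apply: subset_closure; exists l.
  by move=> _ [[l Nl <-] Vl]; exists (j l).
apply: h2 => A B lA lB.
have [N [zN cN sNA]] := regular_closed_nbhs r2 lA.
exists (j l); split; last exact: nbhs_singleton lB.
apply: sNA; apply: contrapT => Nl; apply: (key _ _ zN cN).
by apply: subset_closure; exists l.
Qed.

(** [j] extends along [i] and [i] along [j]; the composites fix a dense set pointwise, hence are
    identities by the Hausdorff property. *)
Lemma homeomorphism_of_separation (L : Type) (Y1 Y2 : topologicalType)
    (i : L -> Y1) (j : L -> Y2) :
  hausdorff_space Y1 -> compact [set: Y1] -> closure (range i) = setT ->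
  (forall A, closure (i @` A) `&` closure (i @` ~` A) = set0) ->
  hausdorff_space Y2 -> compact [set: Y2] -> closure (range j) = setT ->
  (forall A, closure (j @` A) `&` closure (j @` ~` A) = set0) ->
  exists2 phi : Y1 -> Y2, homeomorphism phi & forall l, phi (i l) = j l.
Proof.
move=> h1 c1 d1 s1 h2 c2 d2 s2.
have [phi cphi phiE] := continuous_extension j d1 s1 h2 c2.
have [psi cpsi psiE] := continuous_extension i d2 s2 h1 c1.
have id_of (M : Type) (Y : topologicalType) (k : M -> Y) (f : Y -> Y) :
    hausdorff_space Y -> closure (range k) = setT -> continuous f ->
    (forall l, f (k l) = k l) -> forall y, f y = y.
  move=> hY dk cf fk y; apply: hY => A B yA yB.
  have : closure (range k) y by rewrite dk.
  have yfA : nbhs y (f @^-1` A) by exact: cf.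
  case/(_ _ (filterI yfA yB)) => _ [[l _ <-] [/= Al Bl]].
  by exists (k l); split=> //; rewrite -fk.
exists phi => //; split=> //; exists psi; split=> //.
- apply: (id_of _ _ i (psi \o phi) h1 d1) => [x|l /=]; last by rewrite phiE psiE.
  by apply: continuous_comp; [exact: cphi|exact: cpsi].
- apply: (id_of _ _ j (phi \o psi) h2 d2) => [x|l /=]; last by rewrite psiE phiE.
  by apply: continuous_comp; [exact: cpsi|exact: cphi].
Qed.

Lemma compact_closure_sub (T : topologicalType) (A : set T) :
  hausdorff_space T -> compact A -> forall B, B `<=` A -> compact (closure B).
Proof.
move=> hT cA B sBA; have clA : closed A by exact: compact_closed.
apply: subclosed_compact cA _; first exact: closed_closure.
exact: closure_sub_closed.
Qed.

Lemma closure_range_set_val (T : topologicalType) (B : Type) (A : set T)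
    (g : B -> closure A) :
  (forall a, A a -> exists b, set_val (g b) = a) -> closure (range g) = setT.
Proof.
move=> gA; rewrite -subTset => z _ N [_ [[W oW <-] Wz sWN]].
have [|a [/gA[b bE] Wa]] := set_mem (valP z) W; first by apply: open_nbhs_nbhs.
by exists (g b); split; [exists b|apply: sWN; rewrite /= bE].
Qed.

(** * The Stone-Čech compactification and Čech-completeness *)

Lemma stone_cech_compact (R : realType) (X : topologicalType) :
  compact [set: stone_cech R X].
Proof.
apply: set_type_compact.
have := @ptws_compact (unit_map R X) R _ (@segment_compact R 0 1).
move/(compact_closure_sub (ptws_hausdorff (@Rhausdorff R))); apply.
by move=> _ [x _ <-] f; apply: (svalP f).2; exists x.
Qed.

Lemma stone_cech_hausdorff (R : realType) (X : topologicalType) :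
  hausdorff_space (stone_cech R X).
Proof. by apply: set_type_hausdorff; apply: ptws_hausdorff; exact: Rhausdorff. Qed.

Lemma stone_cech_unit_dense (R : realType) (X : topologicalType) :
  closure (range (@stone_cech_unit R X)) = setT.
Proof. by apply: closure_range_set_val => _ [x _ <-]; exists x. Qed.

Lemma stone_cech_coord_continuous (R : realType) (X : topologicalType)
    (f : unit_map R X) :
  continuous (fun z : stone_cech R X => set_val z f).
Proof.
move=> z.
apply: (@continuous_comp (stone_cech R X) {ptws unit_map R X -> R} R set_val
  (fun g => g f)).
  exact: set_val_continuous.
exact: ptws_eval_continuous.
Qed.

Lemma stone_cech_unit_continuous (R : realType) (X : topologicalType) :
  continuous (@stone_cech_unit R X).
Proof.
apply: continuous_comp_initial => x.
apply/cvg_sup => f; apply/cvg_image.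
  by apply/seteqP; split=> // y _; exists (fun=> y).
move=> /= N xN; rewrite nbhs_filterE.
exists ((fun g : {ptws unit_map R X -> R} => g f) @^-1` N).
  exact: (svalP f).1 _ _ xN.
by apply/seteqP; split=> [_ [g Ng <-]//|y Ny]; exists (fun=> y).
Qed.

(** If [x] is outside [closure V], a function equal to 0 at [x] and to 1 on [V] is itself a
    coordinate of the cube and separates the images. *)
Lemma closure_stone_cech_unit (R : realType) (X : topologicalType)
    (V : set X) (x : X) : completely_regular_space X ->
  closure (@stone_cech_unit R X @` V) (stone_cech_unit R x) -> closure V x.
Proof.
move=> cX clx; apply: contrapT => /(cX _ _ (@closed_closure _ V)).
case/(@uniform_separatorP _ R) => f [cf f01 fx fV].
pose u : unit_map R X := exist _ f (conj cf f01).
have [] := clx [set z | set_val z u < 1/2].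
  apply: (@stone_cech_coord_continuous R X u _ [set y | y < 1/2]).
  apply: open_nbhs_nbhs; split; first exact: open_lt.
  have -> : set_val (stone_cech_unit R x) u = 0 by apply: fx; exists x.
  by rewrite /= divr_gt0.
move=> _ [[v Vv <-] /=].
have -> : set_val (stone_cech_unit R v) u = 1.
  by apply: fV; exists v => //; exact: subset_closure.
by rewrite ltr_pdivlMr// mul1r ltNge ler1n.
Qed.

(* [C n V]: the closure of V in the compactification lies in the n-th open set
   of a family whose intersection is X. *)
Lemma cech_complete_sieve (R : realType) (X : topologicalType) :
  completely_regular_space X -> cech_complete R X ->
  exists C : nat -> set (set X),
    (forall n x U, nbhs x U -> exists V, [/\ open V, V x, V `<=` U & C n V]) /\
    (forall V : nat -> set X, (forall n, V n !=set0) ->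
       (forall n, V n.+1 `<=` V n) -> (forall n, C n (V n.+1)) ->
       exists x, forall n, closure (V n) x).
Proof.
move=> cX [W oW rangeE].
exists (fun n V => closure (@stone_cech_unit R X @` V) `<=` W n); split.
  move=> n x U xU.
  have Wn : nbhs (stone_cech_unit R x) (W n).
    apply: open_nbhs_nbhs; split=> //.
    have : range (@stone_cech_unit R X) (stone_cech_unit R x) by exists x.
    by rewrite rangeE; apply.
  have [N [xN cN sNW]] := regular_closed_nbhs
    (compact_hausdorff_regular (@stone_cech_hausdorff R X)
      (@stone_cech_compact R X)) Wn.
  have : nbhs x (U `&` @stone_cech_unit R X @^-1` N).
    by apply: filterI => //; exact: stone_cech_unit_continuous.
  rewrite nbhsE => -[V [oV Vx] sV]; exists V; split=> //.
    by move=> y /sV[].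
  apply: subset_trans sNW; apply: closure_sub_closed => // _ [y /sV[_ Ny] <-].
  exact: Ny.
move=> V V0 dV CV.
have dVm m n : (m <= n)%N -> V n `<=` V m.
  move=> /subnK <-; elim: (n - m)%N => [|k IH] //.
  by apply: subset_trans IH; exact: dV.
have FF : ProperFilter (filter_from setT V).
  apply: filter_from_proper; last by move=> n _; exact: V0.
  apply: filter_from_filter; first by exists 0%N.
  move=> m n _ _; exists (maxn m n) => // x Vx.
  by split; apply: dVm Vx; rewrite ?leq_maxl ?leq_maxr.
have [|z [_ clz]] := @stone_cech_compact R X
    (@stone_cech_unit R X @ filter_from setT V) _.
  exact: filterT.
have zV n : closure (@stone_cech_unit R X @` V n) z.
  move=> N zN; apply: clz => //; exists n => // x Vx.
  by exists x.
(* The cluster point [z] lies in every [W n], hence comes from a point of [X]. *)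
have : range (@stone_cech_unit R X) z.
  by rewrite rangeE => n _; apply: (CV n); exact: zV.
case=> x _ xz; exists x => n; apply: (@closure_stone_cech_unit R) => //.
by rewrite xz.
Qed.

(** * Cluster points: of a map along dense open sets, of a non-equicontinuous family *)

Lemma somewhere_dense_preimage (X K : topologicalType) (h : X -> K) :
  [set: X] !=set0 -> compact [set: K] ->
  exists k : K, forall D, nbhs k D -> exists U0, [/\ open U0, U0 !=set0 &
    forall U, open U -> U !=set0 -> U `<=` U0 -> exists2 p, U p & D (h p)].
Proof.
move=> [x0 _] cK.
pose dense_open := [set U : set X | open U /\ dense U].
have FF : ProperFilter (filter_from dense_open id).
  apply: filter_from_proper; last first.
    by move=> U [_ /(_ setT)[||x [_ Ux]]]; [exists x0|exact: openT|exists x].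
  apply: filter_from_filter.
    exists setT; split; first exact: openT.
    by move=> U [x Ux] _; exists x.
  move=> U V [oU dU] [oV dV]; exists (U `&` V) => //.
  by split; [exact: openI|exact: denseI].
have [|k [_ clk]] := cK (h @ filter_from dense_open id) _; first exact: filterT.
exists k => D kD; apply: contrapT => nU0.
pose V := \bigcup_(U in [set U | open U /\ forall x, U x -> ~ D (h x)]) U.
have dV : dense_open V.
  split; first by apply: bigcup_open => U [].
  move=> U U0 oU; apply: contrapT => nUV; apply: nU0; exists U; split=> //.
  move=> U' oU' [x U'x] sU'U; apply: contrapT => nU'; apply: nUV.
  exists x; split; first exact: sU'U.
  by exists U' => //; split=> // y U'y Dy; apply: nU'; exists y.
have [] := clk (h @` V) D _ kD; first by exists V => // x Vx; exists x.
by move=> _ [[x [U [_ UD] Ux] <-] /UD]; apply.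
Qed.

(** As [U] shrinks to [x0], the members [g] for which [g x0] and [g y] are not [E]-close for some
    [y] in [U] form a filter base; [h] is a cluster point of it, by Tychonoff. *)
Lemma not_equicontinuous_cluster (X : topologicalType) (K : puniformType)
    (G : set (X -> K)) : compact [set: K] -> ~ equicontinuous G id ->
  exists (x0 : X) (E : set (K * K)) (h : {ptws X -> K}), entourage E /\
    forall N U, nbhs h N -> nbhs x0 U ->
      exists g y, [/\ G g, N g, U y & ~ E (g x0, g y)].
Proof.
move=> cK; rewrite /equicontinuous => /existsNP[x0 /existsNP[E /not_implyP[eE nE]]].
exists x0, E.
pose B U := [set g : {ptws X -> K} | G g /\ exists2 y, U y & ~ E (g x0, g y)].
have FF : ProperFilter (filter_from (nbhs x0) B).
  apply: filter_from_proper.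
    apply: filter_from_filter; first by exists setT; exact: filterT.
    move=> U V x0U x0V; exists (U `&` V); first exact: filterI.
    by move=> g [Gg [y [Uy Vy] gy]]; split; (split; [|exists y]).
  move=> U x0U; apply: contrapT => nB; apply: nE.
  apply: filterS x0U => y Uy g Gg; apply: contrapT => gy; apply: nB.
  by exists g; split=> //; exists y.
have cT : compact [set: {ptws X -> K}].
  have := @ptws_compact X K setT cK.
  by congr (@compact {ptws X -> K} _); apply/seteqP; split.
have [|h [_ clh]] := cT (filter_from (nbhs x0) B) FF; first exact: filterT.
exists h; split=> // N U hN x0U.
have [g [[Gg [y Uy gy]] Ng]] : B U `&` N !=set0 by apply: clh => //; exists U.
by exists g, y.
Qed.

Lemma mulg_continuous_left (G : topologicalGroupType) (a : G) :
  continuous (fun x : G => (a * x)%g).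
Proof.
move=> x; apply: (@continuous_comp _ _ _ (fun x : G => (a, x))
  (fun xy : G * G => (xy.1 * xy.2)%g)); last exact: mulg_continuous.
by apply: cvg_pair; [exact: cvg_cst|exact: cvg_id].
Qed.

(** Since [g y = g x0 * g (x0^-1 * y)], translation moves the failure to the identity. One [V]
    serves all the [g] obtained, because their [g x0] are kept close to the fixed point
    [k = h x0]. *)
Lemma not_equicontinuous_CHom (X : topologicalGroupType) (K : uniformGroupType)
    (G : set (X -> K)) : G `<=` CHom X K -> compact [set: K] ->
  ~ equicontinuous G id ->
  exists (h : {ptws X -> K}) (V : set K), nbhs (1%g : K) V /\
    forall N W, nbhs h N -> nbhs (1%g : X) W ->
      exists g w, [/\ G g, N g, W w & ~ V (g w)].
Proof.
move=> GH cK /(not_equicontinuous_cluster cK)[x0 [E [h [eE hE]]]].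
pose E' := split_ent E.
have eE' : entourage E' by exact: entourage_split_ent.
pose k := h x0.
have : nbhs (k, 1%g : K) ((fun xy : K * K => (xy.1 * xy.2)%g) @^-1` [set y | E' (k, y)]).
  apply: mulg_continuous; rewrite /= mulg1.
  by rewrite -nbhs_entourageE; exists E' => // y /xsectionP.
case=> -[P V] /= [kP V1] sPV.
exists h, V; split=> // N W hN W1.
have kP' : nbhs k (P `&` [set p | E' (p, k)]).
  apply: filterI => //; rewrite -nbhs_entourageE.
  by exists (E'^-1)%relation; [exact: entourage_inv|move=> p /xsectionP].
have [||g [y [Gg [Ng [Pg Eg]] Wy nE]]] := hE
    (N `&` [set g : {ptws X -> K} | (P `&` [set p | E' (p, k)]) (g x0)])
    [set y | W (x0^-1 * y)%g].
- by apply: filterI => //; exact: (@ptws_eval_continuous X K x0 h _ kP').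
- by apply: (@mulg_continuous_left X x0^-1%g x0); rewrite mulVg.
exists g, (x0^-1 * y)%g; split=> // Vg; apply: nE.
have [_ gM] := GH g Gg.
have -> : g y = (g x0 * g (x0^-1 * y))%g by rewrite -gM mulgA mulgV mul1g.
apply: (entourage_split k) => //.
exact: (sPV (g x0, g (x0^-1 * y)%g)).
Qed.

(** * A Cantor scheme of open sets in the group *)

(** [Q] comes before [A] and [B] so that these can be fitted to it: by regularity for general [K],
    as level sets of a function for U(n). *)
Lemma CHom_cantor_scheme (R : realType) (X : topologicalGroupType)
    (K : uniformGroupType) (G : set (X -> K)) :
  completely_regular_space X -> cech_complete R X -> compact [set: K] ->
  G `<=` CHom X K -> ~ equicontinuous G id ->
  exists (k : K) (Q : set K), nbhs k Q /\
    forall A B, nbhs k A -> closed A -> closed B ->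
      (forall q, ~ Q q -> nbhs q B) ->
      exists g : nat -> X -> K, (forall n, G (g n)) /\
        forall s : nat -> bool, exists x, forall n,
          if s n then B (g n x) else A (g n x).
Proof.
move=> crX /(cech_complete_sieve crX)[C [CV Cx]] cK GH nG.
have [h [V [V1 hV]]] := not_equicontinuous_CHom GH cK nG.
have [|k kD] := somewhere_dense_preimage h _ cK; first by exists 1%g.
(* For the pair of values [g p] and [g (p * w)] the quotient is [g w]: having them in [P1] and [P2]
   would force [g w] into [V]. *)
have : nbhs (k, k) ((fun xy : K * K => (xy.1^-1 * xy.2)%g) @^-1` V).
  have c : continuous (fun xy : K * K => (xy.1^-1 * xy.2)%g).
    move=> xy; apply: (@continuous_comp _ _ _
      (fun xy : K * K => (xy.1^-1%g, xy.2)) (fun xy : K * K => (xy.1 * xy.2)%g)).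
      apply: cvg_pair; last exact: cvg_snd.
      by apply: (@continuous_comp _ _ _ fst (fun x : K => x^-1%g));
        [exact: cvg_fst|exact: invg_continuous].
    exact: mulg_continuous.
  by apply: c; rewrite /= mulVg.
case=> -[P1 P2] /= [kP1 kP2] sP.
exists k, (P1 `&` P2); split; first exact: filterI.
move=> A B kA cA cB QB.
pose D := (A `&` (P1 `&` P2))^°.
have nD : nbhs k D by apply: nbhs_interior; apply: filterI => //; exact: filterI.
have oD : open D by exact: open_interior.
have [U0 [oU0 U00 hU0]] := kD D nD.
(* Only words of length [n] matter at level [n]; the newest digit is the head of the word. *)
pose good n (S : seq bool -> set X) := forall s, size s = n ->
  [/\ open (S s), S s !=set0 & S s `<=` U0].
pose next n (S : seq bool -> set X) (q : (seq bool -> set X) * (X -> K)) :=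
  [/\ G q.2, good n.+1 q.1 & forall s b, size s = n ->
    [/\ q.1 (b :: s) `<=` S s, C n (q.1 (b :: s)) & forall x, q.1 (b :: s) x ->
      if b then B (q.2 x) else A (q.2 x)]].
have step n S : good n S -> exists q, next n S q.
  move=> gS.
  (* Tuples form a finite type, so one [g] and one [w] can meet the open conditions of all words of
     the level at once. *)
  have /choice[p pP] (t : n.-tuple bool) : exists x, S t x /\ D (h x).
    have [oS S0 sS] := gS t (size_tuple t).
    by have [x Sx Dx] := hU0 _ oS S0 sS; exists x.
  have [||g [w [Gg Dg Ww nVg]]] := hV [set g : {ptws X -> K} | forall t, D (g (p t))]
      [set w | forall t : n.-tuple bool, S t (p t * w)%g].
  - apply: (@filter_forall _ _ (fun t => [set g : {ptws X -> K} | D (g (p t))])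
      (nbhs h)) => t.
    apply: (@ptws_eval_continuous X K (p t) h D).
    by apply: open_nbhs_nbhs; split=> //; exact: (pP t).2.
  - apply: (@filter_forall _ _ (fun t : n.-tuple bool =>
      [set w | S t (p t * w)%g]) (nbhs (1%g : X))) => t.
    apply: (@mulg_continuous_left X (p t) 1%g (S t)); rewrite mulg1.
    have [oS _ _] := gS t (size_tuple t).
    by apply: open_nbhs_nbhs; split=> //; exact: (pP t).1.
  have [cg gM] := GH g Gg.
  have inA t : nbhs (g (p t)) A.
    apply: (filterS _ (open_nbhs_nbhs (conj oD (Dg t)))).
    by move=> y /interior_subset[].
  have inB t : nbhs (g (p t * w)%g) B.
    apply: QB => -[Q1 Q2]; apply: nVg.
    have [_ [Q1' Q2']] := interior_subset (Dg t).
    have := sP (g (p t), g (p t * w)%g) (conj Q1' Q2).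
    by rewrite /= gM mulgA mulVg mul1g.
  (* The default [true] is reached only by the empty word, which does not belong to level [n.+1]. *)
  have /choice[S' S'P] (s : seq bool) : exists V, size (behead s) = n ->
      [/\ open V, V !=set0, V `<=` S (behead s), C n V & forall x, V x ->
        if head true s then B (g x) else A (g x)].
    have [sn|] := pselect (size (behead s) = n); last by exists set0.
    pose t := Tuple (introT eqP sn).
    pose x := if head true s then (p t * w)%g else p t.
    have xS : S (behead s) x.
      by rewrite /x; case: head; [exact: (Ww t)|exact: (pP t).1].
    have : nbhs x (S (behead s) `&` [set x | if head true s then B (g x) else A (g x)]).
      have [oS _ _] := gS _ sn.
      apply: filterI; first by apply: open_nbhs_nbhs; split.
      rewrite /x; case: head; [exact: (cg _ _ (inB t))|exact: (cg _ _ (inA t))].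
    move=> /(CV n)[V' [oV' V'x sV' CV']]; exists V' => _; split=> //.
    - by exists x.
    - by move=> y /sV'[].
    - by move=> y /sV'[].
  exists (S', g); split=> //=.
    move=> [//|b s] [sn]; have [oV' V0 sV' _ _] := S'P (b :: s) sn.
    split=> //; apply: subset_trans sV' _.
    by have [] := gS s sn.
  by move=> s b sn; have [_ _ ? ? ?] := S'P (b :: s) sn.
(* Choice asks for a total function; where [good] fails the value is arbitrary. *)
have /choice[F FP] (nS : nat * (seq bool -> set X)) :
    exists q, good nS.1 nS.2 -> next nS.1 nS.2 q.
  have [/step[q qP]|] := pselect (good nS.1 nS.2); first by exists q.
  by exists (nS.2, fun=> 1%g).
pose S_ := fix S_ n := if n is m.+1 then (F (m, S_ m)).1 else fun=> U0.
have gS n : good n (S_ n).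
  elim: n => [|n IH]; first by move=> s _; split.
  by have [] := FP (n, S_ n) IH.
exists (fun n => (F (n, S_ n)).2); split=> [n|s].
  by have [] := FP (n, S_ n) (gS n).
(* [b n] lists the first [n] digits of [s], the last one first. *)
pose b := fix b n := if n is m.+1 then s m :: b m else [::].
have szb n : size (b n) = n by elim: n => //= n ->.
have [|||x xP] := Cx (fun n => S_ n (b n)).
- by move=> n; have [] := gS n (b n) (szb n).
- move=> n; have [_ _ /(_ (b n) (s n) (szb n))[]] := FP (n, S_ n) (gS n).
  by [].
- move=> n; have [_ _ /(_ (b n) (s n) (szb n))[]] := FP (n, S_ n) (gS n).
  by [].
exists x => n; have [Gg _ /(_ (b n) (s n) (szb n))[_ _]] := FP (n, S_ n) (gS n).
have [cg _] := GH _ Gg.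
(* [x] is only known to lie in the closure of the set of level [n.+1]; the condition passes to it
   because [A] and [B] are closed and the [n]-th map is continuous. *)
have := xP n.+1; rewrite /= -/S_.
move=> clx; case: (s n) clx => clx Sg.
  exact: (closure_sub_closed (closed_comp (fun y _ => cg y) cB) Sg clx).
exact: (closure_sub_closed (closed_comp (fun y _ => cg y) cA) Sg clx).
Qed.

(** * From independent sequences to the Stone-Čech compactification *)

(** Complementary subsets of [L] are separated in both spaces: in the compactification of the
    discrete set by an indicator function, in the closure of [L] by evaluation at the point [x]
    given for [P]. *)
Lemma closure_canonically_beta_of_separation (R : realType) (X : Type)
    (K : topologicalType) (L : set {ptws X -> K}) (A B : set K) :
  hausdorff_space K -> compact [set: K] -> closed A -> closed B ->
  (forall k, A k -> ~ B k) ->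
  (forall P : set {ptws X -> K}, exists x, forall g, L g ->
    (P g -> B (g x)) /\ (~ P g -> A (g x))) ->
  closure_canonically_beta R L.
Proof.
move=> hK cK cA cB AB sepL.
pose j (l : discrete_topology L) : closure L :=
  SigSub (mem_set (subset_closure (set_mem (valP l)))).
have [||||||||phi hphi phiE] := @homeomorphism_of_separation (discrete_topology L) _ _
    (@stone_cech_unit R (discrete_topology L)) j.
- exact: stone_cech_hausdorff.
- exact: stone_cech_compact.
- exact: stone_cech_unit_dense.
- move=> P.
  pose f (l : discrete_topology L) : R := \1_P l.
  have cf : continuous f.
    by move=> l U; rewrite nbhs_principalE => /nbhs_singleton fU ? ->.
  have f01 : range f `<=` `[0, 1].
    by move=> _ [l _ <-]; rewrite /= in_itv/= /f indicE; case: (_ \in _);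
      rewrite ?lexx ?ler01.
  pose u : unit_map R (discrete_topology L) := exist _ f (conj cf f01).
  have clu c : closed [set z : stone_cech R (discrete_topology L) | set_val z u = c].
    apply: (@closed_comp _ _ (fun z : stone_cech R _ => set_val z u) [set c]).
      by move=> z _; exact: stone_cech_coord_continuous.
    exact: closed_eq.
  apply/seteqP; split=> // z [cl1 cl0].
  have z1 : set_val z u = 1.
    apply: (closure_sub_closed (clu 1) _ cl1) => _ [l Pl <-] /=.
    by rewrite -[LHS]/(f l) /f indicE mem_set.
  have : set_val z u = 0.
    apply: (closure_sub_closed (clu 0) _ cl0) => _ [l Pl <-] /=.
    by rewrite -[LHS]/(f l) /f indicE memNset.
  by rewrite z1 => /eqP; rewrite oner_eq0.
- by apply: set_type_hausdorff; exact: ptws_hausdorff.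
- apply: set_type_compact.
  apply: (compact_closure_sub (ptws_hausdorff hK) (ptws_compact cK)).
  by [].
- by apply: closure_range_set_val => g Lg; exists (SigSub (mem_set Lg)).
- move=> P.
  have [x xP] := sepL [set g | exists2 l : L, P l & g = set_val l].
  have cl (D : set K) : closed D -> closed [set z : closure L | D (set_val z x)].
    move=> cD; apply: (@closed_comp _ _ (fun z : closure L => set_val z x) D) => //.
    move=> z _; apply: (@continuous_comp (closure L) {ptws X -> K} K set_val
      (fun g => g x)).
      exact: set_val_continuous.
    exact: ptws_eval_continuous.
  apply/seteqP; split=> // z [cl1 cl0].
  have Bz : B (set_val z x).
    apply: (closure_sub_closed (cl B cB) _ cl1) => _ [l Pl <-] /=.
    by apply: (xP _ (set_mem (valP l))).1; exists l.
  have Az : A (set_val z x).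
    apply: (closure_sub_closed (cl A cA) _ cl0) => _ [l Pl <-] /=.
    apply: (xP _ (set_mem (valP l))).2 => -[l' Pl' /val_inj ll'].
    by apply: Pl; rewrite ll'.
  by case: (AB _ Az Bz).
exists phi; split=> // l.
by rewrite phiE.
Qed.

Lemma range_independent_beta (R : realType) (X : Type) (K : topologicalType)
    (A B : set K) (g : nat -> {ptws X -> K}) :
  hausdorff_space K -> compact [set: K] -> closed A -> closed B ->
  (forall k, A k -> ~ B k) ->
  (forall s : nat -> bool, exists x, forall n,
    if s n then B (g n x) else A (g n x)) ->
  [/\ countable (range g), infinite_set (range g) &
      closure_canonically_beta R (range g)].
Proof.
move=> hK cK cA cB AB gP.
have gI : injective g.
  (* For [n] other than [m], the pattern true only at [m] would put the common value in both [A] and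
     [B]. *)
  move=> m n gmn; have [x xP] := gP (fun k => k == m).
  apply/eqP; rewrite eq_sym; apply/negPn/negP => /negPf nm.
  have := xP m; have := xP n; rewrite eqxx nm gmn => Ax Bx.
  exact: (AB _ Ax Bx).
split.
- exact: card_image_le.
- rewrite (eq_finite_set (inj_card_eq _)) => [|m n _ _ /gI //].
  exact: infinite_nat.
apply: (closure_canonically_beta_of_separation R hK cK cA cB AB) => P.
have [x xP] := gP (fun n => `[< P (g n) >]).
exists x => _ [n _ <-]; have := xP n; case: asboolP; split=> //.
Qed.

(** * Extension of bounded sequences by binary expansion *)

(** The functions [v k] extending the digits are bounded by 1 on all of [T], so their series with
    weights [e k.+1] converges uniformly on [T] and has a continuous sum. *)
Lemma bounded_extension_of_independent (R : realType) (T : topologicalType)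
    (t : nat -> T) (r : nat -> R) (c : R) :
  (forall s : nat -> bool, exists v : T -> R,
    [/\ continuous v, forall y, 0 <= v y <= 1 & forall n, v (t n) = (s n)%:R]) ->
  0 < c -> (forall n, `|r n| <= c) ->
  exists F : T -> R, continuous F /\ forall n, F (t n) = r n.
Proof.
move=> ts c0 rc.
have cM (a : R) (f : T -> R) : continuous f -> continuous (fun y => a * f y).
  by move=> cf y; apply: cvgM; [exact: cvg_cst|exact: cf].
(* Binary expansion of r / c with digits 1 and -1; [rho k n] is the remainder. *)
pose sg (b : bool) : R := 2 * b%:R - 1.
pose rho := fix rho k n := if k is k'.+1 then 2 * rho k' n - sg (0 <= rho k' n)%R
  else r n / c.
have rho1 k n : `|rho k n| <= 1.
  elim: k => [|k].
    by rewrite /= normrM normfV (gtr0_norm c0) ler_pdivrMr// mul1r.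
  by rewrite /= /sg !ler_norml; case: (leP 0 (rho k n)) => /= h; lra.
have /choice[w wP] k := ts (fun n => 0 <= rho k n).
pose v k y : R := 2 * w k y - 1.
have vt k n : v k (t n) = sg (0 <= rho k n).
  by rewrite /v; have [_ _ ->] := wP k.
have v1 k y : - 1 <= v k y <= 1.
  by rewrite /v; have [_ /(_ y) + _] := wP k; lra.
have cv k : continuous (v k).
  move=> y; have [cw _ _] := wP k.
  by apply: cvgB; [exact: (cM _ _ cw y)|exact: cvg_cst].
pose e m : R := 2^-1 ^+ m.
have e0 m : 0 < e m by rewrite exprn_gt0.
have eS m : e m = 2 * e m.+1 by rewrite /e exprS; lra.
pose S := fix S m y := if m is m'.+1 then S m' y + e m'.+1 * v m' y else 0.
have cS m : continuous (S m).
  elim: m => [|m IH] y; first exact: cvg_cst.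
  by apply: cvgD; [exact: IH|exact: (cM _ _ (cv m) y)].
have St m n : r n / c = S m (t n) + e m * rho m n.
  elim: m => [|m ->]; first by rewrite /e expr0 add0r mul1r.
  by rewrite [S _.+1 _]/= vt eS /=; lra.
have mono m p y : S m y - e m <= S (p + m)%N y - e (p + m)%N /\
    S (p + m)%N y + e (p + m)%N <= S m y + e m.
  elim: p => [|p]; first by rewrite add0n.
  have := v1 (p + m)%N y; have := e0 (p + m).+1.
  by rewrite addSn [S _.+1 _]/= (eS (p + m)%N); nra.
have SU m p y : S m y - e m <= S p y + e p.
  have [mp|/ltnW pm] := leqP m p.
    by have := mono m (p - m)%N y; rewrite subnK//; have := e0 p; lra.
  by have := mono p (m - p)%N y; rewrite subnK//; have := e0 m; lra.
(* The intervals of centre S m y and radius e m are nested: the supremum of their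
   left endpoints is the sum of the series. *)
pose A y := [set S m y - e m | m in [set: nat]].
have hA y : has_sup (A y).
  split; first by exists (S 0%N y - e 0%N); exists 0%N.
  by exists (S 0%N y + e 0%N) => _ [m _ <-].
have AF m y : `|sup (A y) - S m y| <= e m.
  rewrite ler_distl; apply/andP; split.
    by apply: sup_upper_bound => //; exists m.
  by apply: ge_sup => [|_ [p _ <-]]; [exact: (hA y).1|].
have e_lt d : 0 < d -> exists m, e m < d.
  move=> d0.
  have /cvgrPdist_lt/(_ _ d0)[m _ /(_ m (leqnn m))] : e @ \oo --> (0 : R).
    by apply: cvg_expr; rewrite gtr0_norm// invf_lt1// ltr1n.
  by rewrite /= sub0r normrN gtr0_norm//; exists m.
exists (fun y => c * sup (A y)); split.
  apply: cM => y; apply/cvgrPdist_lt => d d0.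
  have [m em] : exists m, e m < d / 3 by apply: e_lt; rewrite divr_gt0.
  have : \forall z \near y, `|S m y - S m z| < d / 3.
    by have /cvgrPdist_lt := cS m y; apply; rewrite divr_gt0.
  apply: filterS => z Smz.
  have := AF m y; have := AF m z; move: Smz; rewrite !ltr_norml !ler_norml; lra.
move=> n.
suff -> : sup (A (t n)) = r n / c by rewrite mulrCA divff ?mulr1// gt_eqF.
(* Both numbers lie within [e m] of [S m (t n)], for every [m]. *)
apply/eqP; rewrite -subr_eq0 -normr_le0; apply/ler_addgt0Pr => d d0.
have [m em] : exists m, e m < d / 2 by apply: e_lt; rewrite divr_gt0.
have := AF m (t n); have := rho1 m n; rewrite add0r (St m n) !ler_norml.
by have := e0 m; nra.
Qed.

(** * Complex matrices and compactness of the unitary group *)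

Lemma Re_continuous (R : realType) : continuous (fun z : R[i] => complex.Re z).
Proof.
move=> z; apply/(cvgrPdist_lt (FF := fmap_filter _ (nbhs_filter z))) => e e0.
exists e%:C%C; first by rewrite /= ltcR.
move=> w zw; rewrite /= -ltcR; apply: le_lt_trans zw.
by rewrite -raddfB; exact: normc_ge_Re.
Qed.

Lemma normc_ge_Im (R : rcfType) (z : R[i]) : `|complex.Im z|%:C%C <= `|z|.
Proof.
by case: z => a b; rewrite normc_def lecR -sqrtr_sqr ler_wsqrtr//= lerDr sqr_ge0.
Qed.

Lemma Im_continuous (R : realType) : continuous (fun z : R[i] => complex.Im z).
Proof.
move=> z; apply/(cvgrPdist_lt (FF := fmap_filter _ (nbhs_filter z))) => e e0.
exists e%:C%C; first by rewrite /= ltcR.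
move=> w zw; rewrite /= -ltcR; apply: le_lt_trans zw.
by rewrite -raddfB; exact: normc_ge_Im.
Qed.

Lemma real_complex_continuous (R : realType) :
  continuous (fun x : R => x%:C%C : R[i]).
Proof.
(* Radii of balls are complex numbers here; positivity makes the imaginary part [d'] vanish. *)
move=> x U [[d d'] /= + sU]; rewrite ltcE /= => /andP[/eqP de d0].
exists d => // y xy; apply: sU.
by rewrite /= de -raddfB normc_def /= expr0n addr0 sqrtr_sqr ltcR.
Qed.

Lemma complex_continuous (R : realType) (T : topologicalType) (a b : T -> R) :
  continuous a -> continuous b ->
  continuous (fun x => (a x +i* b x)%C : R[i]).
Proof.
move=> ca cb x.
rewrite (_ : (fun _ => _) = fun x => (a x)%:C%C + 'i%C * (b x)%:C%C :> R[i]).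
  apply: cvgD.
    by apply: (continuous_comp (ca x)); exact: real_complex_continuous.
  apply: cvgM; first exact: cvg_cst.
  by apply: (continuous_comp (cb x)); exact: real_complex_continuous.
apply/funext => y; apply/eqP; rewrite eq_complex /=.
by apply/andP; split; apply/eqP; ring.
Qed.

Lemma continuous_matrix_complex (R : realType) (T : topologicalType) m n
    (a b : 'I_m -> 'I_n -> T -> R) :
  (forall i j, continuous (a i j)) -> (forall i j, continuous (b i j)) ->
  continuous (fun x => \matrix_(i, j) (a i j x +i* b i j x)%C : 'M[R[i]]_(m, n)).
Proof.
move=> ca cb; apply: continuous_matrix => i j.
under eq_fun do rewrite mxE.
exact: complex_continuous.
Qed.

Lemma matrix_complex_hausdorff (R : realType) m n :
  hausdorff_space 'M[R[i]]_(m, n).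
Proof.
move=> A B clAB; apply/matrixP => i j.
apply: (@norm_hausdorff R[i] R[i]^o) => U V AU BV.
have [M [MU MV]] := clAB _ _ (@coord_continuous R[i] m n i j A U AU)
  (@coord_continuous R[i] m n i j B V BV).
by exists (M i j).
Qed.

(** This set is a continuous image of a Tychonoff cube, whose boolean index selects real or
    imaginary part. *)
Lemma bounded_matrix_complex_compact (R : realType) m n (c : R) :
  compact [set A : 'M[R[i]]_(m, n) | forall i j,
    -c <= complex.Re (A i j) <= c /\ -c <= complex.Im (A i j) <= c].
Proof.
have := @ptws_compact ('I_m * 'I_n * bool) R _ (@segment_compact R (-c) c).
move=> /(@continuous_compact _ _ (fun f : {ptws 'I_m * 'I_n * bool -> R} =>
  \matrix_(i, j) (f (i, j, true) +i* f (i, j, false))%C : 'M[R[i]]_(m, n))).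
move=> H; have {H} := H _.
rewrite (_ : image _ _ = [set A : 'M[R[i]]_(m, n) | forall i j,
    -c <= complex.Re (A i j) <= c /\ -c <= complex.Im (A i j) <= c]).
  apply; apply: continuous_subspaceT.
  by apply: continuous_matrix_complex => i j; exact: ptws_eval_continuous.
apply/seteqP; split=> [_ [f /= fc <-] i j|A Ac].
  have := fc (i, j, true); have := fc (i, j, false).
  by rewrite mxE /= !in_itv.
exists (fun ijb => if ijb.2 then complex.Re (A ijb.1.1 ijb.1.2)
  else complex.Im (A ijb.1.1 ijb.1.2)).
  move=> [[i j] b] /=; have [] := Ac i j.
  by case: b; rewrite in_itv.
by apply/matrixP => i j; rewrite mxE /=; case: (A i j).
Qed.

(** The squared moduli along row [i] add up to a diagonal entry of the identity matrix. *)
Lemma unitary_entry_le1 (C : numClosedFieldType) n (A : 'M[C]_n) i j :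
  A \is unitarymx -> `|A i j| <= 1.
Proof.
move=> /unitarymxP/matrixP/(_ i i); rewrite !mxE eqxx mulr1n => A1.
rewrite -(@expr_le1 _ 2)// -A1 (bigD1 j)//= !mxE normCK lerDl.
by apply: sumr_ge0 => k _; rewrite !mxE -normCK exprn_ge0.
Qed.

Lemma continuous_hermitian_sum (R : realType) (T : topologicalType) n
    (a b : 'I_n -> T -> R[i]) :
  (forall k, continuous (a k)) -> (forall k, continuous (b k)) ->
  continuous (fun x => \sum_k a k x * Num.conj (b k x)).
Proof.
move=> ca cb x; apply: cvg_big => [|k _]; first exact: add_continuous.
apply: cvgM; first exact: ca.
apply: (@continuous_comp _ _ _ (b k)); first exact: cb.
exact: conjC_continuous.
Qed.

Lemma unitary_set_closed (R : realType) n : closed (@unitary_set R n).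
Proof.
have -> : @unitary_set R n = \bigcap_(ij in [set: 'I_n * 'I_n])
    [set A | \sum_k A ij.1 k * Num.conj (A ij.2 k) = (ij.1 == ij.2)%:R].
  apply/seteqP; split=> [A /unitarymxP/matrixP AA [i j] _ /=|A AA].
    by have := AA i j; rewrite !mxE => <-; apply: eq_bigr => k _; rewrite !mxE.
  apply/unitarymxP/matrixP => i j; have := AA (i, j) I; rewrite !mxE /= => <-.
  by apply: eq_bigr => k _; rewrite !mxE.
apply: closed_bigI => -[i j] _ /=.
apply: (@closed_comp _ _ (fun A : 'M[R[i]]_n => \sum_k A i k * Num.conj (A j k))
  [set (i == j)%:R]).
  move=> A _; apply: (@continuous_hermitian_sum R 'M[R[i]]_n n
    (fun k A => A i k) (fun k A => A j k)) => k.
    exact: (@coord_continuous R[i] n n i k).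
  exact: (@coord_continuous R[i] n n j k).
apply: accessible_closed_set1; apply: hausdorff_accessible.
exact: (@norm_hausdorff R[i] R[i]^o).
Qed.

Lemma unitary_group_compact (R : realType) n : compact [set: unitary_group R n].
Proof.
apply: (@set_type_compact _ (@unitary_set R n)).
apply: subclosed_compact (@bounded_matrix_complex_compact R n n 1) _.
  exact: unitary_set_closed.
move=> A Au i j; have := unitary_entry_le1 i j Au.
move=> A1; rewrite -!ler_norml -!lecR; split.
  exact: le_trans (normc_ge_Re _) A1.
exact: le_trans (normc_ge_Im _) A1.
Qed.

Lemma unitary_group_hausdorff (R : realType) n :
  hausdorff_space (unitary_group R n).
Proof.
exact: (@set_type_hausdorff _ (@unitary_set R n)
  (@matrix_complex_hausdorff R n n)).
Qed.

(** * Interpolation by matrix-valued functions *)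

Lemma precompact_image_bounded (R : realType) (T : Type) (M : topologicalType)
    (S : set T) (h : T -> M) (f : M -> R) : precompact (h @` S) -> continuous f ->
  exists2 c, 0 < c & forall x, S x -> `|f (h x)| <= c.
Proof.
rewrite precompactE => hS cf.
have /compact_bounded/pinfty_ex_gt0[c c0 fc] :=
  continuous_compact (continuous_subspaceT cf) hS.
exists c => // x Sx; apply: fc; exists (h x) => //.
by apply: subset_closure; exists x.
Qed.

(** Real and imaginary parts of the entries are extended separately; the 0-1 functions needed on the
    product are [u] composed with evaluation at a point realizing the pattern. *)
Lemma interpolation_set_of_independent (R : realType) (X : Type) m n
    (g : nat -> X -> 'M[R[i]]_(m, n)) (u : 'M[R[i]]_(m, n) -> R) :
  continuous u -> (forall M, 0 <= u M <= 1) ->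
  (forall s : nat -> bool, exists x, forall k, u (g k x) = (s k)%:R) ->
  interpolation_set (range g).
Proof.
move=> cu u01 gs h ph.
have indep (s : nat -> bool) : exists v : {ptws X -> 'M[R[i]]_(m, n)} -> R,
    [/\ continuous v, forall y, 0 <= v y <= 1 & forall k, v (g k) = (s k)%:R].
  have [x xP] := gs s; exists (fun y => u (y x)); split=> // y.
  apply: (@continuous_comp _ _ _ (fun y : {ptws X -> _} => y x) u).
    exact: ptws_eval_continuous.
  exact: cu.
have extend (f : 'M[R[i]]_(m, n) -> R) : continuous f ->
    exists F : {ptws X -> 'M[R[i]]_(m, n)} -> R,
      continuous F /\ forall k, F (g k) = f (h (g k)).
  move=> cf; have [c c0 hc] := precompact_image_bounded ph cf.
  by apply: bounded_extension_of_independent indep c0 _ => k; apply: hc; exists k.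
have cij (p : R[i] -> R) i j : continuous p ->
    continuous (fun A : 'M[R[i]]_(m, n) => p (A i j)).
  move=> cp A; apply: (@continuous_comp _ _ _ (fun A : 'M[R[i]]_(m, n) => A i j) p).
    exact: (@coord_continuous R[i] m n i j).
  exact: cp.
have /choice[a aP] (ij : 'I_m * 'I_n) :=
  extend _ (cij _ ij.1 ij.2 (@Re_continuous R)).
have /choice[b bP] (ij : 'I_m * 'I_n) :=
  extend _ (cij _ ij.1 ij.2 (@Im_continuous R)).
exists (fun y => \matrix_(i, j) (a (i, j) y +i* b (i, j) y)%C); split.
  apply: (@continuous_matrix_complex R {ptws X -> 'M[R[i]]_(m, n)} m n
    (fun i j => a (i, j)) (fun i j => b (i, j))) => i j.
    exact: (aP (i, j)).1.
  exact: (bP (i, j)).1.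
move=> _ [k _ <-]; apply/matrixP => i j; rewrite mxE.
by rewrite (aP (i, j)).2 (bP (i, j)).2 /=; case: (h (g k) i j).
Qed.

(** Flattening a separating function near 0 and near 1 turns its level sets into neighbourhoods, as
    [CHom_cantor_scheme] requires of [A] and [B]. *)
Lemma urysohn_plateau (R : realType) (T : topologicalType) (x : T) (W : set T) :
  completely_regular_space T -> nbhs x W ->
  exists u : T -> R, [/\ continuous u, forall y, 0 <= u y <= 1,
    nbhs x [set y | u y = 0] & forall y, ~ W y -> nbhs y [set z | u z = 1]].
Proof.
move=> cT; rewrite {1}nbhsE => -[U [oU Ux] sUW].
have /(@uniform_separatorP _ R)[f [cf f01 fx fU]] : uniform_separator [set x] (~` U).
  by apply: cT; [exact: open_closedC|].
have near y (P : set R) : nbhs (f y) P -> nbhs y (f @^-1` P) by exact: cf.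
(* [cl] is 0 up to 1/3, affine up to 2/3, and 1 from there on. *)
pose cl (t : R) := Num.max 0 (Num.min 1 (3 * t - 1)).
exists (fun y => cl (f y)); split.
- move=> y; apply: (@continuous_max R T (fun=> 0) (fun y => Num.min 1 (3 * f y - 1))).
    exact: cvg_cst.
  apply: (@continuous_min R T (fun=> 1) (fun y => 3 * f y - 1)).
    exact: cvg_cst.
  apply: cvgB; last exact: cvg_cst.
  by apply: cvgM; [exact: cvg_cst|exact: cf].
- by move=> y; rewrite /cl le_max lexx/= ge_max ler01 ge_min lexx.
- apply: filterS (near x [set t | t < 1/3] _).
    move=> y /= fy; rewrite /cl max_l// ge_min; apply/orP; right; lra.
  apply: open_nbhs_nbhs; split; first exact: open_lt.
  have -> : f x = 0 by apply: fx; exists x.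
  by rewrite /= divr_gt0.
- move=> y nWy; apply: filterS (near y [set t | 2/3 < t] _).
    move=> z /= fz; rewrite /cl min_l ?max_r//; lra.
  apply: open_nbhs_nbhs; split; first exact: open_gt.
  have -> : f y = 1 by apply: fU; exists y => // /sUW.
  by rewrite /= ltr_pdivrMr// mul1r ltr_nat.
Qed.

(** * Choice of the two closed sets, for compact [K] and for U(n) *)

Theorem theorem2 (R : realType) (X : topologicalGroupType)
    (X_infinite : infinite_set [set: X]) (X_hausdorff : hausdorff_space X)
    (X_creg : completely_regular_space X) (X_cech : cech_complete R X) :
  (forall K : uniformGroupType,
     infinite_set [set: K] -> hausdorff_space K -> compact [set: K] ->
     forall G : set (X -> K),
     G `<=` CHom X K -> ~ equicontinuous G id ->
     exists L : set (X -> K),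
       [/\ L `<=` G, countable L, infinite_set L & closure_canonically_beta R L])
  /\
  (forall n : nat, (0 < n)%N ->
     forall G : set (X -> unitary_group R n),
     G `<=` CHom X (unitary_group R n) -> ~ equicontinuous G id ->
     exists L : set (X -> unitary_group R n),
       [/\ L `<=` G, countable L, infinite_set L,
           closure_canonically_beta R L &
           interpolation_set (M := 'M[R[i]]_n)
             [set (fun x => set_val (g x)) | g in L]]).
Proof.
split=> [K _ hK cK G GH nG|n _ G GH nG].
  have [k [Q [kQ hQ]]] := CHom_cantor_scheme X_creg X_cech cK GH nG.
  have rK := compact_hausdorff_regular hK cK.
  (* [A] lies in the interior of [Q'], and the other closed set is the complement of that interior;
     it contains the open complement of [Q'], so it is a neighbourhood of each point outside [Q]. *)
  have [Q' [kQ' cQ' sQ'Q]] := regular_closed_nbhs rK kQ.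
  have [A [kA cA sAQ']] := regular_closed_nbhs rK (nbhs_interior kQ').
  have cB : closed (~` Q'^°) by apply: open_closedC; exact: open_interior.
  have [|g [gG gs]] := hQ A (~` Q'^°) kA cA cB.
    move=> q nQq; apply: filterS (open_nbhs_nbhs (conj (closed_openC cQ') _)).
      by move=> p nQ'p /interior_subset.
    by move=> /sQ'Q.
  have AB p : A p -> ~ (~` Q'^°) p by move=> /sAQ' Q'p; apply.
  have [cL iL bL] := range_independent_beta R hK cK cA cB AB gs.
  by exists (range g); split=> // _ [m _ <-].
have cK := @unitary_group_compact R n.
have hK := @unitary_group_hausdorff R n.
have [k [Q [kQ hQ]]] := CHom_cantor_scheme X_creg X_cech cK GH nG.
(* A trace of an open set [W] of matrices lies inside [Q]: interpolation needs [u] on the whole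
   matrix space, beyond the unitary group. *)
have [_ [[W oW <-] /= Wk sWQ]] := kQ.
have cM : completely_regular_space 'M[R[i]]_n.
  exact: (@uniform_completely_regular R).
have [u [cu u01 uk u1]] := urysohn_plateau R cM (open_nbhs_nbhs (conj oW Wk)).
(* With the exact levels 0 and 1 as closed sets, [u] of the value at [x] is the digit of the pattern
   itself. *)
pose lvl c := [set q : unitary_group R n | u (set_val q) = c].
have cv : continuous (set_val : unitary_group R n -> 'M[R[i]]_n).
  exact: initial_continuous.
have cl c : closed (lvl c).
  apply: (@closed_comp _ _ (fun q : unitary_group R n => u (set_val q)) [set c]).
    by move=> q _; apply: continuous_comp; [exact: cv|exact: cu].
  exact: closed_eq.
have [||g [gG gs]] := hQ (lvl 0) (lvl 1) _ (cl 0) (cl 1).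
- exact: cv uk.
- by move=> q nQq; apply: (cv q _ (u1 _ _)) => /sWQ.
have AB p : lvl 0 p -> ~ lvl 1 p.
  by rewrite /lvl /= => -> /eqP; rewrite eq_sym oner_eq0.
have [cL iL bL] := range_independent_beta R hK cK (cl 0) (cl 1) AB gs.
exists (range g); split=> //; first by move=> _ [m _ <-].
rewrite image_comp.
apply: (interpolation_set_of_independent cu u01) => s.
have [x xP] := gs s; exists x => m; have := xP m.
by rewrite /comp; case: (s m).
Qed.
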